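(* For every $\epsilon>0$ there are $n,N\in \mathbb{N}$ and an injective unital completely positive map $\phi:M_n\rightarrow M_N$ with $\Vert\phi^{-1}\Vert_{cb}\leq 1+\epsilon$ such that $\Vert\phi-\psi\Vert\geq 3/4$ for every complete order embedding $\psi:M_n\rightarrow M_N$.
   Context: $M_n$ is the $C^*$-algebra of complex $n\times n$ matrices. A linear map between $C^*$-algebras is a complete order embedding if it is completely positive and completely isometric (it need not be unital). For an injective linear map $\phi:A\to B$ with closed range, $\Vert\phi^{-1}\Vert_{cb}$ denotes the completely bounded norm of the inverse map $\phi^{-1}:\phi(A)\to A$. The norm $\Vert\phi-\psi\Vert$ is the usual operator norm of a linear map between normed spaces. *)

(* Defs.v *)
From HB Require Import structures.
From mathcomp Require Import all_boot all_order all_algebra.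
From mathcomp Require Import all_classical all_reals ereal.
From mathcomp Require Export complex.
Set Implicit Arguments.
Unset Strict Implicit.
Unset Printing Implicit Defensive.
Import Order.TTheory GRing.Theory Num.Theory.
Local Open Scope classical_set_scope.
Local Open Scope ring_scope.
Local Open Scope sesquilinear_scope.

(* Throughout, R is the field of real numbers, R[i] the field of complex
   numbers, and M_n is 'M[R[i]]_n acting on the Hilbert space 'cV[R[i]]_n. *)

Definition l2norm (R : realType) (n : nat) (v : 'cV[R[i]]_n) : R :=
  Num.sqrt (\sum_(i < n) Normc.normc (v i 0) ^+ 2).

(* The C*-norm of M_n. The real supremum is taken over a nonempty bounded set,
   see mxopnorm_has_sup below. *)
Definition mxopnorm (R : realType) (n : nat) (A : 'M[R[i]]_n) : R :=
  sup [set l2norm (A *m v) | v in [set v : 'cV[R[i]]_n | l2norm v <= 1]].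

(* 0 <= z in R[i] means that z is real and nonnegative, so this condition
   entails that A is Hermitian. *)
Definition psdmx (R : realType) (n : nat) (A : 'M[R[i]]_n) : Prop :=
  forall v : 'cV[R[i]]_n, 0 <= (v ^t* *m A *m v) 0 0.

(* An element of M_k(M_n) is a k x k matrix with entries in M_n; flatmx is the
   canonical identification of M_k(M_n) with M_{kn}. The k-th amplification of
   a map f : M_m -> M_n is then map_mx f. *)
Definition flatmx (R : realType) (k n : nat) (A : 'M['M[R[i]]_n]_k) :
    'M[R[i]]_(\sum_(i < k) n) :=
  \mxblock_(i < k, j < k) A i j.

Definition completely_positive (R : realType) (m n : nat)
    (f : 'M[R[i]]_m -> 'M[R[i]]_n) : Prop :=
  forall (k : nat) (A : 'M['M[R[i]]_m]_k),
    psdmx (flatmx A) -> psdmx (flatmx (map_mx f A)).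

Definition completely_isometric (R : realType) (m n : nat)
    (f : 'M[R[i]]_m -> 'M[R[i]]_n) : Prop :=
  forall (k : nat) (A : 'M['M[R[i]]_m]_k),
    mxopnorm (flatmx (map_mx f A)) = mxopnorm (flatmx A).

Definition complete_order_embedding (R : realType) (m n : nat)
    (f : 'M[R[i]]_m -> 'M[R[i]]_n) : Prop :=
  completely_positive f /\ completely_isometric f.

Definition opnorm (R : realType) (m n : nat)
    (f : 'M[R[i]]_m -> 'M[R[i]]_n) : \bar R :=
  ereal_sup [set (mxopnorm (f A))%:E | A in [set A | mxopnorm A <= 1]].

(* The completely bounded norm of the restriction of f to the subspace S of
   M_m, where M_k(S) is normed as a subspace of M_k(M_m). *)
Definition cbnorm_on (R : realType) (m n : nat) (S : set 'M[R[i]]_m)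
    (f : 'M[R[i]]_m -> 'M[R[i]]_n) : \bar R :=
  ereal_sup [set ereal_sup
      [set (mxopnorm (flatmx (map_mx f A)))%:E
        | A in [set A : 'M['M[R[i]]_m]_k |
                 (forall i j, S (A i j)) /\ mxopnorm (flatmx A) <= 1]]
    | k in [set: nat]].

(* || f^-1 : f(M_m) -> M_m ||_cb for an injective f; the value 0 given to the
   partial inverse outside range f is irrelevant. *)
Definition cbnorm_inv (R : realType) (m n : nat)
    (f : 'M[R[i]]_m -> 'M[R[i]]_n) : \bar R :=
  cbnorm_on (range f) ('pinv_(fun=> 0) [set: 'M[R[i]]_m] f).

Lemma l2norm0 (R : realType) (n : nat) : l2norm (0 : 'cV[R[i]]_n) = 0.
Proof.
rewrite /l2norm big1 ?sqrtr0// => i _.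
by rewrite mxE Normc.normc0 expr0n.
Qed.

Lemma normc_le_l2norm (R : realType) (n : nat) (v : 'cV[R[i]]_n) (i : 'I_n) :
  Normc.normc (v i 0) <= l2norm v.
Proof.
have n0 (z : R[i]) : 0 <= Normc.normc z by case: z => a b; exact: sqrtr_ge0.
rewrite -(ger0_norm (n0 (v i 0))) -sqrtr_sqr ler_wsqrtr//.
rewrite (bigD1 i)//= lerDl sumr_ge0// => j _.
exact: sqr_ge0.
Qed.

Lemma mxopnorm_has_sup (R : realType) (n : nat) (A : 'M[R[i]]_n) :
  has_sup [set l2norm (A *m v) | v in [set v : 'cV[R[i]]_n | l2norm v <= 1]].
Proof.
have n0 (z : R[i]) : 0 <= Normc.normc z by case: z => a b; exact: sqrtr_ge0.
split; first by exists (l2norm (A *m 0)), 0; rewrite //= l2norm0.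
exists (Num.sqrt (\sum_i (\sum_j Normc.normc (A i j)) ^+ 2)) => _ [v /= v1 <-].
rewrite ler_wsqrtr// ler_sum// => i _; rewrite lerXn2r ?nnegrE ?sumr_ge0//.
rewrite mxE (@le_trans _ _ (\sum_j Normc.normc (A i j * v j 0)))//.
  elim/big_ind2 : _ => [|x y z t xy zt|//]; first by rewrite Normc.normc0.
  by rewrite (le_trans (le_normcD _ _))// lerD.
rewrite ler_sum// => j _; rewrite Normc.normcM ler_piMr//.
exact: le_trans (normc_le_l2norm v j) v1.
Qed.

(* Main.v *)
Require Import Defs.
From HB Require Import structures.
From mathcomp Require Import all_boot all_order all_algebra.
From mathcomp Require Import all_classical all_reals ereal.
From mathcomp Require Import ring lra.
Set Implicit Arguments.
Unset Strict Implicit.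
Unset Printing Implicit Defensive.
Import Order.TTheory GRing.Theory Num.Theory.
Local Open Scope ring_scope.
Local Open Scope sesquilinear_scope.

(** Let [f_j], [j = 0 .. n], be vectors of a [K]-dimensional space with
    [f_0 = 0] and the others unit (or zero) vectors, and let [P] be the
    projection with diagonal blocks [P_j], the projections onto the orthogonal
    complements of the [f_j]. With [Q = 1 - P], the unital completely positive
    map is
      [phi(A) = P (A (x) 1_K) P + a_00 Q].

    It is almost completely isometric for large [K], whatever the [f_j]. Each
    block of [Q] has rank at most one, so that for a vector [x] the squared
    norms of the [K] vectors [Q (x (x) g_t)], with [g_t] an orthonormal basis,
    have sum at most [|x|^2]: on average [x (x) g_t] nearly lies in the range of
    [P], where [phi(A)] compresses [A (x) 1]. The same holds after
    amplification, and summing squared norms over [t] bounds the norm of [A] by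
    [1 + eps] times that of [phi(A)] ([kraus_lower_bound],
    [kraus_cbnorm_inv]).

    On the other hand let [psi] be completely isometric. The columns of the
    [e_i0] and of the [psi(e_i0)] have the same norm, the square root of the
    number of rows, so there is a vector [w] in the unit ball with
    [|psi(e_i0) w|] close to 1 for all [i] at once ([ci_column]). But
    [phi(e_i0) w] has norm [|P_i w_0|] for [i <> 0], where [w_0] is the block 0
    of [w] ([kraus_column]). If the lines of the [f_i] are dense enough, a net
    of the unit ball being finite ([projective_net]), some [P_i w_0] is small,
    and [phi(e_i0) - psi(e_i0)] has norm at least [3/4]. *)

(** * Adjoints and squared norms *)

Section Adjoint.
Context {R : realType}.
Local Notation C := R[i].

Lemma ctrM m n p (A : 'M[C]_(m, n)) (B : 'M[C]_(n, p)) :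
  (A *m B)^t* = B^t* *m A^t*.
Proof. by rewrite trmx_mul map_mxM. Qed.

Lemma ctrK m n (A : 'M[C]_(m, n)) : A^t*^t* = A.
Proof. by apply/matrixP=> i j; rewrite !mxE conjCK. Qed.

Lemma ctrB m n (A B : 'M[C]_(m, n)) : (A - B)^t* = A^t* - B^t*.
Proof. by rewrite linearB map_mxB. Qed.

Lemma ctr0 m n : (0 : 'M[C]_(m, n))^t* = 0.
Proof. by rewrite trmx0 map_mx0. Qed.

Lemma ctr1 n : (1%:M : 'M[C]_n)^t* = 1%:M.
Proof. by rewrite tr_scalar_mx map_scalar_mx /= rmorph1. Qed.

Lemma ctr_delta m n i j : (delta_mx i j : 'M[C]_(m, n))^t* = delta_mx j i.
Proof. by rewrite trmx_delta map_delta_mx. Qed.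

Lemma mx11D (X Y : 'M[C]_1) : (X + Y) 0 0 = X 0 0 + Y 0 0.
Proof. by rewrite mxE. Qed.

Lemma mx11B (X Y : 'M[C]_1) : (X - Y) 0 0 = X 0 0 - Y 0 0.
Proof. by rewrite !mxE. Qed.

(** The square of [l2norm]. Norm estimates are carried out on squares, with
    [sqnD_le] in place of the triangle inequality. *)
Definition sqn n (v : 'cV[C]_n) : R := \sum_(i < n) Normc.normc (v i 0) ^+ 2.

Lemma l2norm_sqn n (v : 'cV[C]_n) : l2norm v = Num.sqrt (sqn v).
Proof. by []. Qed.

Lemma sqn_ge0 n (v : 'cV[C]_n) : 0 <= sqn v.
Proof. by apply: sumr_ge0 => i _; apply: sqr_ge0. Qed.

Lemma l2norm_sqr n (v : 'cV[C]_n) : l2norm v ^+ 2 = sqn v.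
Proof. by rewrite sqr_sqrtr ?sqn_ge0. Qed.

Lemma l2norm_ge0 n (v : 'cV[C]_n) : 0 <= l2norm v.
Proof. exact: sqrtr_ge0. Qed.

Lemma sqn_dot n (v : 'cV[C]_n) : (v^t* *m v) 0 0 = (sqn v)%:C%C.
Proof.
rewrite mxE /sqn raddf_sum /=; apply: eq_bigr => i _.
rewrite !mxE mulrC -normCK rmorphXn /=.
by case: (v i 0).
Qed.

Lemma sqn0 n : sqn (0 : 'cV[C]_n) = 0.
Proof. by apply: complexI; rewrite -sqn_dot mulmx0 mxE. Qed.

Lemma dotC n (u v : 'cV[C]_n) : (v^t* *m u) 0 0 = ((u^t* *m v) 0 0)^*.
Proof. by rewrite -[u in LHS]ctrK -ctrM !mxE; congr (_ ^*); rewrite mxE. Qed.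
End Adjoint.

Section Sqn.
Context {R : realType}.
Local Notation C := R[i].

Lemma sqnM m n (A : 'M[C]_(m, n)) (v : 'cV[C]_n) :
  (sqn (A *m v))%:C%C = (v^t* *m (A^t* *m A) *m v) 0 0.
Proof. by rewrite -sqn_dot ctrM !mulmxA. Qed.

Lemma sqnZ n (c : C) (v : 'cV[C]_n) :
  sqn (c *: v) = Normc.normc c ^+ 2 * sqn v.
Proof.
rewrite /sqn mulr_sumr; apply: eq_bigr => i _.
by rewrite mxE Normc.normcM exprMn.
Qed.

Lemma sqnN n (v : 'cV[C]_n) : sqn (- v) = sqn v.
Proof. by apply: eq_bigr => i _; rewrite mxE normcN. Qed.

Lemma sqn_eq0 n (v : 'cV[C]_n) : (sqn v == 0) = (v == 0).
Proof.
apply/eqP/eqP => [v0|->]; last exact: sqn0.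
apply/colP => i; rewrite mxE; apply: Normc.eq0_normc.
have /eqP := v0; rewrite psumr_eq0 => [/allP/(_ i)|? _]; last exact: sqr_ge0.
by rewrite mem_index_enum => /(_ isT); rewrite /= sqrf_eq0 => /eqP.
Qed.

Lemma sqnD_le n (eta : R) (u v : 'cV[C]_n) : 0 < eta ->
  sqn (u + v) <= (1 + eta) * sqn u + (1 + eta^-1) * sqn v.
Proof.
move=> eta0; rewrite /sqn !mulr_sumr -big_split /=; apply: ler_sum => i _.
rewrite mxE; set a := u i 0; set b := v i 0.
have n0 (z : C) : 0 <= Normc.normc z by case: z => p q; exact: sqrtr_ge0.
apply: (@le_trans _ _ ((Normc.normc a + Normc.normc b) ^+ 2)).
  by rewrite ler_pXn2r ?nnegrE ?addr_ge0 ?le_normcD.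
rewrite -subr_ge0.
set p := Normc.normc a; set q := Normc.normc b.
have -> : (1 + eta) * p ^+ 2 + (1 + eta^-1) * q ^+ 2 - (p + q) ^+ 2
  = eta * (p - eta^-1 * q) ^+ 2 by field; rewrite gt_eqF.
by rewrite mulr_ge0 ?sqr_ge0// ltW.
Qed.

Lemma dot_le n (u v : 'cV[C]_n) :
  2 * complex.Re ((u^t* *m v) 0 0) <= sqn u + sqn v.
Proof.
have := sqn_ge0 (u - v).
have -> : sqn (u - v) = complex.Re (((u - v)^t* *m (u - v)) 0 0).
  by rewrite sqn_dot.
rewrite ctrB mulmxBl !mulmxBr !mx11B.
rewrite !sqn_dot (dotC u v); case: ((u^t* *m v) 0 0) => x y /=; lra.
Qed.

Lemma sqn_delta n (i : 'I_n) : sqn (delta_mx i 0 : 'cV[C]_n) = 1.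
Proof.
apply: complexI; rewrite -sqn_dot ctr_delta mul_delta_mx mxE eqxx.
by [].
Qed.

Lemma mxopnorm_ge0 n (A : 'M[C]_n) : 0 <= mxopnorm A.
Proof.
apply: le_trans (l2norm_ge0 (A *m 0)) _.
apply: ub_le_sup; first by have [] := mxopnorm_has_sup A.
by exists 0 => //=; rewrite l2norm0.
Qed.

Lemma mxopnormP n (A : 'M[C]_n) (v : 'cV[C]_n) :
  sqn (A *m v) <= mxopnorm A ^+ 2 * sqn v.
Proof.
have [->|v0] := eqVneq v 0; first by rewrite mulmx0 sqn0 mulr0.
have s0 : 0 < sqn v by rewrite lt_def sqn_eq0 v0 sqn_ge0.
have l0 : 0 < l2norm v by rewrite l2norm_sqn sqrtr_gt0.
pose w := ((l2norm v)^-1)%:C%C *: v.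
have cn (x : R) : Normc.normc (x%:C%C) ^+ 2 = x ^+ 2.
  by rewrite /= expr0n addr0 sqr_sqrtr ?sqr_ge0.
have vl := l2norm_sqr v.
have sw : sqn w = 1.
  by rewrite sqnZ cn -vl exprVn mulVf// expf_neq0// gt_eqF.
have : l2norm (A *m w) <= mxopnorm A.
  apply: ub_le_sup; first by have [] := mxopnorm_has_sup A.
  by exists w => //=; rewrite l2norm_sqn sw sqrtr1.
rewrite -(@ler_pXn2r _ 2) ?nnegrE ?l2norm_ge0 ?mxopnorm_ge0//.
rewrite l2norm_sqr -scalemxAr sqnZ cn exprVn vl.
by rewrite mulrC ler_pdivrMr.
Qed.

Lemma mxopnorm_le n (A : 'M[C]_n) (c : R) : 0 <= c ->
  (forall v, sqn (A *m v) <= c ^+ 2 * sqn v) -> mxopnorm A <= c.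
Proof.
move=> c0 Ac; apply: ge_sup.
  by have [] := mxopnorm_has_sup A.
move=> _ [v /= v1 <-].
rewrite -(@ler_pXn2r _ 2) ?nnegrE ?l2norm_ge0// l2norm_sqr.
apply: le_trans (Ac v) _; rewrite ler_piMr ?sqr_ge0//.
by rewrite -l2norm_sqr -[1](expr1n _ 2) ler_pXn2r ?nnegrE ?l2norm_ge0.
Qed.

(** The supremum defining the norm is approached, not attained: this avoids a
    compactness argument. *)
Lemma mxopnorm_approx n (A : 'M[C]_n) (c : R) : 0 <= c -> c < mxopnorm A ^+ 2 ->
  exists v, sqn v <= 1 /\ c < sqn (A *m v).
Proof.
move=> c0 cA; apply: contrapT => nv; move: cA; apply/negP; rewrite -leNgt.
rewrite -(sqr_sqrtr c0) ler_pXn2r ?nnegrE ?mxopnorm_ge0 ?sqrtr_ge0//.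
apply: ge_sup; first by have [] := mxopnorm_has_sup A.
move=> _ [v /= v1 <-]; rewrite l2norm_sqn ler_wsqrtr// leNgt; apply/negP => cv.
apply: nv; exists v; split=> //.
by rewrite -l2norm_sqr -[1](expr1n _ 2) ler_pXn2r ?nnegrE ?l2norm_ge0.
Qed.
End Sqn.

(** * Maps in Kraus form and a mean-square lower bound *)

Section Kraus.
Context {R : realType}.
Local Notation C := R[i].

(** The map [A |-> \sum_i V_i^* A V_i] with Kraus operators [V_i]. *)
Definition kraus (I : finType) m n (V : I -> 'M[C]_(m, n)) (A : 'M[C]_m) :
  'M[C]_n := \sum_i (V i)^t* *m A *m V i.

Lemma kraus_is_linear (I : finType) m n (V : I -> 'M[C]_(m, n)) :
  linear (kraus V).
Proof.
move=> a A B; rewrite /kraus scaler_sumr -big_split; apply: eq_bigr => i _ /=.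
by rewrite mulmxDr mulmxDl -scalemxAr -scalemxAl.
Qed.

HB.instance Definition _ (I : finType) m n (V : I -> 'M[C]_(m, n)) :=
  GRing.isLinear.Build C 'M[C]_m 'M[C]_n _ (kraus V) (kraus_is_linear V).

Lemma sum_sqn (I : finType) m n (V : I -> 'M[C]_(m, n)) (v : 'cV[C]_n) :
  (\sum_i sqn (V i *m v))%:C%C = (v^t* *m (\sum_i (V i)^t* *m V i) *m v) 0 0.
Proof.
rewrite mulmx_sumr mulmx_suml summxE raddf_sum /=.
by apply: eq_bigr => i _; exact: sqnM.
Qed.

(** A column contraction has a contractive adjoint row. The proof needs no
    square root: the squared norm of [y = \sum_i V_i^* z_i] is the sum of the
    real parts of the inner products of [V_i y] and [z_i], and twice that sum
    is at most [\sum_i |V_i y|^2 + \sum_i |z_i|^2]. *)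
Lemma row_contraction (I : finType) m n (V : I -> 'M[C]_(m, n))
    (z : I -> 'cV[C]_m) :
  (forall v, \sum_i sqn (V i *m v) <= sqn v) ->
  sqn (\sum_i (V i)^t* *m z i) <= \sum_i sqn (z i).
Proof.
move=> V1; set y := (X in sqn X <= _).
have yE : sqn y = \sum_i complex.Re (((V i *m y)^t* *m z i) 0 0).
  have -> : sqn y = complex.Re ((y^t* *m y) 0 0) by rewrite sqn_dot.
  rewrite {2}/y mulmx_sumr summxE raddf_sum /=; apply: eq_bigr => i _.
  by rewrite ctrM mulmxA.
have : 2 * sqn y <= \sum_i sqn (V i *m y) + \sum_i sqn (z i).
  rewrite yE mulr_sumr -big_split /=; apply: ler_sum => i _; exact: dot_le.
have := V1 y; lra.
Qed.

Lemma le_of_sqr_le (eps K b p : R) : 0 < eps ->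
  (1 + eps) * (2 + eps^-1) <= eps * K -> 0 <= b -> 0 <= p ->
  (K - 1) * b ^+ 2 <=
    (1 + eps) * (K * p ^+ 2) + (1 + eps^-1) * b ^+ 2 ->
  b <= (1 + eps) * p.
Proof.
move=> eps0 h1 b0 p0; have e1 : 0 <= 1 + eps by rewrite addr_ge0// ltW.
rewrite -(@ler_pXn2r _ 2 _ b) ?nnegrE ?mulr_ge0//.
have d0 : 0 < eps^-1 by rewrite invr_gt0.
move: (eps^-1) d0 h1 => d d0 h1 h.
(* the difference of the two terms in b^2 leaves the coefficient L *)
pose L := K - 2 - d.
have KL : K <= (1 + eps) * L by rewrite /L; lra.
have L0 : 0 < L.
  have K0 : 0 < K.
    rewrite -(pmulr_rgt0 _ eps0); apply: lt_le_trans h1.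
    by apply: mulr_gt0; apply: addr_gt0.
  rewrite -(@pmulr_rgt0 _ (1 + eps)); first exact: lt_le_trans K0 KL.
  exact: addr_gt0.
rewrite -(ler_pM2l L0).
apply: (@le_trans _ _ ((1 + eps) * (K * p ^+ 2))); first by rewrite /L; lra.
have -> : L * ((1 + eps) * p) ^+ 2 = (1 + eps) * ((1 + eps) * L * p ^+ 2).
  by ring.
by rewrite ler_wpM2l// ler_wpM2r// exprn_ge0.
Qed.

(** The mean-square estimate behind the bound on the inverse. The operators
    [T_t] and [S_j] are the Kraus operators of the map, with [S_j T_t^* = 0],
    and [E_st] is the defect of the orthonormality relations
    [T_s T_t^* = delta_st]. The last two hypotheses say that the defects are
    small in the mean over [t], which runs over [#|I|] values. The vectors
    [T_t^* x] are then test vectors on which the map nearly acts as [B] on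
    [x]. *)
Section LowerBound.
Variables (I J : finType) (m n : nat).
Variables (T : I -> 'M[C]_(m, n)) (S : J -> 'M[C]_(m, n)).
Variables (E : I -> I -> 'M[C]_m) (G : 'M[C]_m).
Hypothesis TS1 : \sum_i (T i)^t* *m T i + \sum_j (S j)^t* *m S j = 1%:M.
Hypothesis ST0 : forall i j, S j *m (T i)^t* = 0.
Hypothesis TTE : forall s t,
  T s *m (T t)^t* = (if s == t then 1%:M else 0) - E s t.
Hypothesis EsqD1 : \sum_t \sum_s (E s t)^t* *m E s t + G^t* *m G = 1%:M.
Hypothesis E1 : \sum_t E t t + G^t* *m G = 1%:M.

(* by TS1, the column with entries T_t is a contraction *)
Let T1 v : \sum_i sqn (T i *m v) <= sqn v.
Proof.
suff -> : sqn v = \sum_i sqn (T i *m v) + \sum_j sqn (S j *m v).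
  by rewrite lerDl sumr_ge0// => j _; exact: sqn_ge0.
apply: complexI; rewrite rmorphD /= !sum_sqn.
by rewrite -mx11D -mulmxDl -mulmxDr TS1 mulmx1 sqn_dot.
Qed.

Let EE v : \sum_t \sum_s sqn (E s t *m v) <= sqn v.
Proof.
suff -> : sqn v = \sum_t \sum_s sqn (E s t *m v) + sqn (G *m v).
  by rewrite lerDl sqn_ge0.
apply: complexI; rewrite rmorphD /= -[in LHS]sqn_dot raddf_sum /= sqnM.
under eq_bigr do rewrite (sum_sqn (E^~ _)).
rewrite -summxE -mulmx_suml -mulmx_sumr.
by rewrite -mx11D -mulmxDl -mulmxDr EsqD1 mulmx1.
Qed.

(* the vectors T_t^* v have almost full mean-square norm *)
Let TK v : (#|I|%:R - 1) * sqn v <= \sum_t sqn ((T t)^t* *m v).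
Proof.
suff -> : \sum_t sqn ((T t)^t* *m v) = (#|I|%:R - 1) * sqn v + sqn (G *m v).
  by rewrite lerDl sqn_ge0.
apply: complexI; rewrite sum_sqn rmorphD rmorphM rmorphB /= rmorph1 rmorph_nat.
rewrite sqnM -sqn_dot mulrBl mul1r.
under eq_bigr do rewrite ctrK TTE eqxx.
rewrite sumrB sumr_const.
have -> : \sum_i E i i = 1%:M - G^t* *m G by rewrite -E1 addrK.
rewrite !mulmxBr !mulmxBl !mulmx1.
rewrite !mx11B.
have -> : (v^t* *m (1%:M *+ #|I|) *m v) 0 0 = #|I|%:R * (v^t* *m v) 0 0.
  by rewrite -scaler_nat -scalemxAr -scalemxAl mulmx1 mxE.
by rewrite opprB addrA addrAC.
Qed.

(** The relation [S_j T_t^* = 0] makes the part [kraus S] of the map invisible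
    on the test vectors, so that
    [Phi(B) T_t^* x = T_t^* B x - \sum_s T_s^* B E_st x]. Summing squared norms
    over [t] gives the estimate. *)
Lemma kraus_lower_bound (eta : R) (B : 'M[C]_m) : 0 < eta ->
  let p := mxopnorm (kraus T B + kraus S B) in
  let b := mxopnorm B in
  (#|I|%:R - 1) * b ^+ 2 <=
    (1 + eta) * (#|I|%:R * p ^+ 2) + (1 + eta^-1) * b ^+ 2.
Proof.
move=> eta0; cbv zeta; set F := (_ + kraus S B).
set p := mxopnorm F; set b := mxopnorm B.
set c := (X in _ <= X).
have eta1 : 0 <= 1 + eta by rewrite addr_ge0// ltW.
have etaV1 : 0 <= 1 + eta^-1 by rewrite addr_ge0// invr_ge0 ltW.
have c0 : 0 <= c.
  apply: addr_ge0; apply: mulr_ge0 => //.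
    by rewrite mulr_ge0// exprn_ge0// mxopnorm_ge0.
  by rewrite exprn_ge0// mxopnorm_ge0.
have main x : (#|I|%:R - 1) * sqn (B *m x) <= c * sqn x.
  apply: le_trans (TK _) _.
  have TBx t : (T t)^t* *m (B *m x) =
      F *m ((T t)^t* *m x) + \sum_s (T s)^t* *m (B *m (E s t *m x)).
    rewrite /F mulmxDl /kraus !mulmx_suml.
    rewrite [X in _ + X + _]big1 ?addr0; last first.
      by move=> j _; rewrite mulmxA -(mulmxA _ (S j)) ST0 mulmx0 mul0mx.
    rewrite -big_split /= (bigD1 t)//= big1 ?addr0; last first.
      move=> s st; rewrite -!mulmxA (mulmxA (T s)) TTE (negPf st) sub0r.
      by rewrite mulNmx !mulmxN addNr.
    rewrite -!mulmxA (mulmxA (T t)) TTE eqxx mulmxBl mul1mx.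
    by rewrite !mulmxBr subrK.
  have Tt t y : sqn ((T t)^t* *m y) <= sqn y.
    have := @row_contraction _ _ _ T (fun s => if s == t then y else 0) T1.
    rewrite (bigD1 t)//= eqxx big1 ?addr0 => [|s /negPf->]; last exact: mulmx0.
    rewrite (bigD1 t)//= eqxx big1 ?addr0// => s /negPf->; exact: sqn0.
  apply: (@le_trans _ _ (\sum_t ((1 + eta) * (p ^+ 2 * sqn x)
      + (1 + eta^-1) * (b ^+ 2 * \sum_s sqn (E s t *m x))))).
    apply: ler_sum => t _; rewrite TBx.
    apply: le_trans (sqnD_le _ _ eta0) _; apply: lerD.
      rewrite ler_wpM2l//.
      by apply: le_trans (mxopnormP _ _) _; rewrite ler_wpM2l ?sqr_ge0.
    rewrite ler_wpM2l//.
    apply: le_trans (row_contraction _ T1) _.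
    by rewrite mulr_sumr; apply: ler_sum => s _; exact: mxopnormP.
  rewrite big_split /= sumr_const -!mulr_sumr /c [leRHS]mulrDl; apply: lerD.
    by rewrite -mulr_natl le_eqVlt; apply/orP; left; apply/eqP; ring.
  rewrite -[leRHS]mulrA ler_wpM2l//; apply: ler_wpM2l; last exact: EE.
  exact: sqr_ge0.
have [K1|K1] := leP (#|I|%:R - 1 : R) 0.
  by apply: le_trans c0; rewrite mulr_le0_ge0 ?sqr_ge0.
rewrite mulrC -ler_pdivlMr//.
have q0 : 0 <= c / (#|I|%:R - 1) by rewrite divr_ge0// ltW.
rewrite -(sqr_sqrtr q0) ler_pXn2r ?nnegrE ?mxopnorm_ge0 ?sqrtr_ge0//.
apply: mxopnorm_le; first exact: sqrtr_ge0.
by move=> v; rewrite sqr_sqrtr// mulrAC ler_pdivlMr// mulrC.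
Qed.
End LowerBound.

End Kraus.

(** * Amplifications and the completely bounded norm of the inverse *)

Section Ampl.
Context {R : realType}.
Local Notation C := R[i].

(** The amplification [1_k (x) X], as a [k] by [k] block diagonal matrix; the
    blocks need not be square, unlike those of [mxdiag]. *)
Definition ampl k m n (X : 'M[C]_(m, n)) :
    'M[C]_(\sum_(i < k) m, \sum_(i < k) n) :=
  \mxblock_(i < k, j < k) (if i == j then X else 0).

Lemma amplM k m n p (X : 'M[C]_(m, n)) (Y : 'M[C]_(n, p)) :
  ampl k (X *m Y) = ampl k X *m ampl k Y.
Proof.
rewrite /ampl mul_mxblock; apply: eq_mxblock => i j.
rewrite (bigD1 i)//= eqxx big1 ?addr0 => [|l /negPf li].
  by case: eqP => // _; rewrite mulmx0.
by rewrite eq_sym li mul0mx.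
Qed.

Lemma ampl_ctr k m n (X : 'M[C]_(m, n)) : (ampl k X)^t* = ampl k (X^t*).
Proof.
rewrite /ampl tr_mxblock; apply/matrixP => i j; rewrite !mxE eq_sym.
by case: eqP => _; rewrite !mxE// rmorph0.
Qed.

Lemma ampl0 k m n : ampl k (0 : 'M[C]_(m, n)) = 0.
Proof.
by rewrite /ampl -[RHS]mxblock0; apply: eq_mxblock => i j; rewrite if_same.
Qed.

Lemma amplD k m n (X Y : 'M[C]_(m, n)) : ampl k (X + Y) = ampl k X + ampl k Y.
Proof.
rewrite /ampl -mxblockD; apply: eq_mxblock => i j.
by case: eqP => // _; rewrite addr0.
Qed.

Lemma amplN k m n (X : 'M[C]_(m, n)) : ampl k (- X) = - ampl k X.
Proof.
rewrite /ampl -mxblockN; apply: eq_mxblock => i j.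
by case: eqP => // _; rewrite oppr0.
Qed.

Lemma ampl_sum k m n (I : finType) (F : I -> 'M[C]_(m, n)) :
  ampl k (\sum_i F i) = \sum_i ampl k (F i).
Proof.
exact: (big_morph (@ampl k m n) (@amplD k m n) (@ampl0 k m n)).
Qed.

Lemma ampl1 k n : ampl k (1%:M : 'M[C]_n) = 1%:M.
Proof.
rewrite -(mxdiagZ (p_ := fun _ : 'I_k => n)) /ampl /mxdiag.
by apply: eq_mxblock => i j; rewrite conform_mx_id.
Qed.

Lemma sum_ampl_gram k m n (I : finType) (F : I -> 'M[C]_(m, n)) :
  \sum_i (ampl k (F i))^t* *m ampl k (F i) =
  ampl k (\sum_i (F i)^t* *m F i).
Proof.
by rewrite ampl_sum; apply: eq_bigr => i _; rewrite ampl_ctr amplM.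
Qed.

Lemma mul_ampl_flat k m n p q (X : 'M[C]_(p, m)) (Y : 'M[C]_(n, q))
    (A : 'I_k -> 'I_k -> 'M[C]_(m, n)) :
  ampl k X *m (\mxblock_(i < k, j < k) A i j) *m ampl k Y =
  \mxblock_(i < k, j < k) (X *m A i j *m Y).
Proof.
rewrite /ampl !mul_mxblock; apply: eq_mxblock => i j.
rewrite (bigD1 j)//= eqxx [X in _ + X]big1 ?addr0 => [|l /negPf lj]; last first.
  by rewrite lj mulmx0.
rewrite (bigD1 i)//= eqxx big1 ?addr0// => l /negPf li.
by rewrite eq_sym li mul0mx.
Qed.

Lemma flat_kraus k (I : finType) m n (V : I -> 'M[C]_(m, n))
    (A : 'M['M[C]_m]_k) :
  flatmx (map_mx (kraus V) A) = kraus (fun i => ampl k (V i)) (flatmx A).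
Proof.
rewrite /flatmx /kraus; under [RHS]eq_bigr do rewrite ampl_ctr mul_ampl_flat.
rewrite -mxblock_sum; apply: eq_mxblock => i j.
by rewrite mxE.
Qed.

Lemma kraus_cp (I : finType) m n (V : I -> 'M[C]_(m, n)) :
  completely_positive (kraus V).
Proof.
move=> k A A0 v; rewrite flat_kraus /kraus mulmx_sumr mulmx_suml summxE.
apply: sumr_ge0 => i _; have := A0 (ampl k (V i) *m v).
by rewrite ctrM !mulmxA.
Qed.

Lemma cbnorm_inv_le m n (f : 'M[C]_m -> 'M[C]_n) (c : R) : 0 <= c ->
  injective f ->
  (forall k (A : 'M['M[C]_m]_k),
    mxopnorm (flatmx A) <= c * mxopnorm (flatmx (map_mx f A))) ->
  (cbnorm_inv f <= c%:E)%E.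
Proof.
move=> c0 finj fc; apply: ge_ereal_sup => _ [k _ <-].
apply: ge_ereal_sup => _ [A [Af A1] <-]; rewrite lee_fin.
pose B : 'M['M[C]_m]_k := map_mx ('pinv_(fun=> 0) [set: 'M[C]_m]%classic f) A.
have fB : map_mx f B = A.
  apply/matrixP => i j; rewrite !mxE; apply: pinvK.
  by rewrite inE; have [X _ <-] := Af i j; exists X.
apply: (le_trans (fc k B)); rewrite fB.
by rewrite ler_piMr.
Qed.

Lemma mxopnorm_eq0 n (A : 'M[C]_n) : mxopnorm A = 0 -> A = 0.
Proof.
move=> A0; apply/matrixP => i j; rewrite mxE.
have : A *m delta_mx j 0 = 0 :> 'cV[C]_n.
  apply/eqP; rewrite -sqn_eq0 eq_le sqn_ge0 andbT.
  by apply: le_trans (mxopnormP _ _) _; rewrite A0 expr0n mul0r.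
by rewrite -colE => /colP/(_ i); rewrite !mxE.
Qed.

Lemma mxopnorm0 n : mxopnorm (0 : 'M[C]_n) = 0.
Proof.
apply/eqP; rewrite eq_le mxopnorm_ge0 andbT; apply: mxopnorm_le => // v.
by rewrite mul0mx sqn0 expr0n mul0r.
Qed.

(** The relations of the mean-square estimate are identities between matrices,
    hence stable under amplification; this turns the norm bound into a bound on
    the completely bounded norm. *)
Section InverseBound.
Variables (I J : finType) (m n : nat).
Variables (T : I -> 'M[C]_(m, n)) (S : J -> 'M[C]_(m, n)).
Variables (E : I -> I -> 'M[C]_m) (G : 'M[C]_m).
Hypothesis TS1 : \sum_i (T i)^t* *m T i + \sum_j (S j)^t* *m S j = 1%:M.
Hypothesis ST0 : forall i j, S j *m (T i)^t* = 0.
Hypothesis TTE : forall s t,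
  T s *m (T t)^t* = (if s == t then 1%:M else 0) - E s t.
Hypothesis EsqD1 : \sum_t \sum_s (E s t)^t* *m E s t + G^t* *m G = 1%:M.
Hypothesis E1 : \sum_t E t t + G^t* *m G = 1%:M.
Variable eps : R.
Hypothesis eps0 : 0 < eps.
Hypothesis epsI : (1 + eps) * (2 + eps^-1) <= eps * #|I|%:R.
Variable V : I + J -> 'M[C]_(m, n).
Hypothesis VT : forall i, V (inl i) = T i.
Hypothesis VS : forall j, V (inr j) = S j.

Lemma krausD A : kraus V A = kraus T A + kraus S A.
Proof.
rewrite /kraus big_sumType /=; congr (_ + _); apply: eq_bigr => i _.
  by rewrite VT.
by rewrite VS.
Qed.

Lemma kraus_inj : injective (kraus V).
Proof.
move=> A B /eqP; rewrite -subr_eq0 -raddfB /= => /eqP AB.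
apply/eqP; rewrite -subr_eq0; apply/eqP; apply: mxopnorm_eq0.
apply/eqP; rewrite eq_le mxopnorm_ge0 andbT.
have := kraus_lower_bound TS1 ST0 TTE EsqD1 E1 (A - B) eps0.
rewrite -krausD AB mxopnorm0 => /(le_of_sqr_le eps0 epsI).
by rewrite mulr0; apply => //; exact: mxopnorm_ge0.
Qed.

Lemma kraus_cbnorm_inv : (cbnorm_inv (kraus V) <= (1 + eps)%:E)%E.
Proof.
apply: cbnorm_inv_le; [by rewrite addr_ge0// ltW|exact: kraus_inj|].
move=> k A; rewrite flat_kraus.
apply: (le_of_sqr_le eps0 epsI); try exact: mxopnorm_ge0.
have -> : kraus (fun i => ampl k (V i)) (flatmx A) =
    kraus (fun i => ampl k (T i)) (flatmx A)
    + kraus (fun j => ampl k (S j)) (flatmx A).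
  by rewrite -!flat_kraus /flatmx -mxblockD; apply: eq_mxblock => i j;
    rewrite !mxE krausD.
apply: (@kraus_lower_bound _ _ _ _ _ _ _
  (fun s t => ampl k (E s t)) (ampl k G)) => //.
- rewrite !sum_ampl_gram -amplD TS1; exact: ampl1.
- by move=> i j; rewrite ampl_ctr -amplM ST0 ampl0.
- move=> s t; rewrite ampl_ctr -amplM TTE amplD amplN.
  by case: eqP => _; rewrite ?ampl1 ?ampl0.
- rewrite (eq_bigr _ (fun t _ => sum_ampl_gram k (E^~ t))) -ampl_sum.
  by rewrite ampl_ctr -amplM -amplD EsqD1; exact: ampl1.
- by rewrite ampl_ctr -amplM -ampl_sum -amplD E1; exact: ampl1.
Qed.
End InverseBound.
End Ampl.

(** * The first column under a complete isometry *)

Section Column.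
Context {R : realType}.
Local Notation C := R[i].

Lemma sqn_mxcol k n (v : 'I_k -> 'cV[C]_n) :
  sqn (\mxcol_(i < k) v i) = \sum_i sqn (v i).
Proof.
apply: complexI; rewrite -sqn_dot tr_mxcol.
have -> : (\mxrow_i (v i)^T) ^ Num.conj = \mxrow_i (v i)^t*.
  by apply/matrixP => i j; rewrite !mxE.
rewrite mul_mxrow_mxcol summxE raddf_sum /=.
by apply: eq_bigr => i _; rewrite sqn_dot.
Qed.

Lemma sqn_submxcol k n (v : 'cV[C]_(\sum_(i < k) n)) :
  sqn v = \sum_i sqn (submxcol v i).
Proof. by rewrite -sqn_mxcol submxcolK. Qed.

Lemma flatmx_mul k m (A : 'M['M[C]_m]_k) (v : 'I_k -> 'cV[C]_m) :
  flatmx A *m (\mxcol_(i < k) v i) = \mxcol_(i < k) (\sum_j A i j *m v j).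
Proof. by rewrite /flatmx mul_mxblock_mxrow. Qed.

Lemma mxopnorm_flat1 m (X : 'M[C]_m) :
  mxopnorm (flatmx (const_mx X : 'M_1)) = mxopnorm X.
Proof.
have col (v : 'cV[C]_m) :
    sqn (flatmx (const_mx X : 'M_1) *m (\mxcol_(i < 1) v)) = sqn (X *m v).
  by rewrite flatmx_mul sqn_mxcol !big_ord1 mxE.
apply/eqP; rewrite eq_le; apply/andP; split; apply: mxopnorm_le;
  rewrite ?mxopnorm_ge0// => v.
  have -> : v = \mxcol_(i < 1) (submxcol v ord0).
    by rewrite -[LHS]submxcolK; apply: eq_mxcol => i; rewrite ord1.
  by rewrite col sqn_mxcol big_ord1; exact: mxopnormP.
rewrite -col; apply: le_trans (mxopnormP _ _) _.
suff -> : sqn (\mxcol_(i < 1) v) = sqn v by [].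
by rewrite sqn_mxcol; exact: big_ord1.
Qed.

Lemma ci_isometric m n (f : 'M[C]_m -> 'M[C]_n) (X : 'M[C]_m) :
  completely_isometric f -> mxopnorm (f X) = mxopnorm X.
Proof.
by move=> /(_ 1 (const_mx X)); rewrite map_const_mx !mxopnorm_flat1.
Qed.

Lemma mxopnorm_delta n (i j : 'I_n) : mxopnorm (delta_mx i j : 'M[C]_n) <= 1.
Proof.
apply: mxopnorm_le => // v; rewrite expr1n mul1r -(mul_delta_mx (0 : 'I_1)).
rewrite -mulmxA -rowE.
have -> : row j v = (v j 0)%:M.
  by apply/matrixP => a b; rewrite !mxE !ord1 eqxx.
rewrite mul_mx_scalar sqnZ sqn_delta mulr1 /sqn (bigD1 j)//= lerDl.
by apply: sumr_ge0 => k _; exact: sqr_ge0.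
Qed.

(** One vector is almost norming for all the images of the first column of
    matrix units. The column with entries [e_i0] has norm the square root of
    [n.+1], and so has the column of the [psi(e_i0)]; a vector almost
    attaining it gives [\sum_i |psi(e_i0) w|^2] close to [n.+1], where each
    of the [n.+1] terms is at most 1. *)
Lemma ci_column n N (psi : {linear 'M[C]_n.+1 -> 'M[C]_N}) (d : R) :
  completely_isometric psi -> 0 < d <= 1 ->
  exists2 w : 'cV[C]_N, sqn w <= 1 &
    forall i, 1 - d <= sqn (psi (delta_mx i ord0) *m w).
Proof.
move=> ci /andP[d0 d1].
(* the column of the e_i0, padded with zero columns *)
pose A : 'M['M[C]_n.+1]_n.+1 :=
  \matrix_(i, j) (if j == ord0 then delta_mx i ord0 else 0).
have nA : n.+1%:R <= mxopnorm (flatmx A) ^+ 2.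
  have := mxopnormP (flatmx A) (\mxcol_(j < n.+1)
    (if j == ord0 then delta_mx ord0 0 else 0)).
  rewrite flatmx_mul.
  have -> : sqn (\mxcol_(j < n.+1)
      (if j == ord0 then delta_mx ord0 0 else 0 : 'cV[C]_n.+1)) = 1.
    rewrite sqn_mxcol (bigD1 ord0)//= sqn_delta big1 ?addr0// => j /negPf->.
    exact: sqn0.
  rewrite mulr1 sqn_mxcol; apply: le_trans.
  rewrite (eq_bigr (fun=> 1)) ?sumr_const ?card_ord// => i _.
  rewrite (bigD1 ord0)//= big1 ?addr0 => [|j /negPf j0]; last first.
    by rewrite j0 mulmx0.
  by rewrite [A i _]mxE /= mul_delta_mx sqn_delta.
have [v [v1]] : exists v, sqn v <= 1 /\
    n.+1%:R - d < sqn (flatmx (map_mx psi A) *m v).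
  apply: mxopnorm_approx; first by rewrite subr_ge0 (le_trans d1)// ler1n.
  rewrite ci; apply: lt_le_trans nA; rewrite ltrBlDr ltrDl//.
rewrite -[v in flatmx _ *m v]submxcolK flatmx_mul sqn_mxcol.
set w := submxcol v ord0.
have w1 : sqn w <= 1.
  apply: le_trans v1; rewrite sqn_submxcol (bigD1 ord0)//= lerDl.
  by apply: sumr_ge0 => i _; exact: sqn_ge0.
rewrite (eq_bigr (fun i => sqn (psi (delta_mx i ord0) *m w))); last first.
  move=> i _; rewrite (bigD1 ord0)//= big1 ?addr0 => [|j /negPf j0].
    by rewrite !mxE.
  by rewrite !mxE j0 raddf0 mul0mx.
move=> hs; exists w => // i.
have le1 j : sqn (psi (delta_mx j ord0) *m w) <= 1.
  apply: le_trans (mxopnormP _ _) _.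
  rewrite (ci_isometric _ ci).
  apply: mulr_ile1; rewrite ?sqn_ge0 ?sqr_ge0//.
  by rewrite expr_le1 ?mxopnorm_ge0 ?mxopnorm_delta.
have : \sum_(j < n.+1 | j != i) sqn (psi (delta_mx j ord0) *m w) <= n%:R.
  apply: (@le_trans _ _ (\sum_(j < n.+1 | j != i) 1)); first exact: ler_sum.
  by rewrite sumr_const cardC1 card_ord.
move: hs; rewrite (bigD1 i)//= -natr1.
by move: (\sum_(j | _) _) (sqn _) n%:R => a b c; lra.
Qed.

Lemma opnorm_ge m n (f : 'M[C]_m -> 'M[C]_n) (A : 'M[C]_m) (c : R) :
  mxopnorm A <= 1 -> c <= mxopnorm (f A) -> (c%:E <= opnorm f)%E.
Proof.
move=> A1 cA; apply: (@le_trans _ _ (mxopnorm (f A))%:E).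
  by rewrite lee_fin.
by apply: ereal_sup_ubound; exists A.
Qed.
End Column.

(** * The map attached to a family of lines *)

Section Construction.
Context {R : realType}.
Local Notation C := R[i].

(** The projection onto the orthogonal complement of [f], when [f] is a unit
    vector; the identity, when [f = 0]. *)
Definition perp K (f : 'cV[C]_K) : 'M[C]_K := 1%:M - f *m f^t*.

Definition unit_or_zero K (f : 'cV[C]_K) := f = 0 \/ f^t* *m f = 1%:M.

Lemma perp_ctr K (f : 'cV[C]_K) : (perp f)^t* = perp f.
Proof. by rewrite ctrB ctr1 ctrM ctrK. Qed.

Lemma perp_mul K (f : 'cV[C]_K) : unit_or_zero f -> perp f *m f = 0.
Proof.
rewrite mulmxBl mul1mx -mulmxA => -[->|->]; first by rewrite mul0mx subrr.
by rewrite mulmx1 subrr.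
Qed.

Lemma perp_idem K (f : 'cV[C]_K) : unit_or_zero f -> perp f *m perp f = perp f.
Proof.
by move=> hf; rewrite {2}/perp mulmxBr mulmx1 mulmxA perp_mul// mul0mx subr0.
Qed.

Lemma perp_gram K (f : 'cV[C]_K) : unit_or_zero f ->
  (perp f)^t* *m perp f + f *m f^t* = 1%:M.
Proof. by move=> hf; rewrite perp_ctr perp_idem// subrK. Qed.

(** The left-hand side is the squared distance from [w] to the line of [f]. *)
Lemma sqn_perp K (f w : 'cV[C]_K) (c : C) : unit_or_zero f ->
  sqn (perp f *m w) <= sqn (w - c *: f).
Proof.
move=> hf; have -> : perp f *m w = perp f *m (w - c *: f).
  by rewrite mulmxBr -scalemxAr perp_mul// scaler0 subr0.
set v := w - _.
have -> : sqn v = sqn (perp f *m v) + sqn (f^t* *m v).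
  apply: complexI; rewrite rmorphD /= !sqnM ctrK.
  by rewrite -mx11D -mulmxDl -mulmxDr perp_gram// mulmx1 sqn_dot.
by rewrite lerDl sqn_ge0.
Qed.

Lemma sum_row_gram k m n (A : 'M[C]_(k, m)) (B : 'M[C]_(k, n)) :
  \sum_t (row t A)^t* *m row t B = A^t* *m B.
Proof.
apply/matrixP => i j; rewrite summxE mxE; apply: eq_bigr => t _.
by rewrite mxE big_ord1 !mxE.
Qed.

(** With [e_j] the basis vectors and [P_j = perp (f j)], the matrices below
    define a map sending [A] to
    [P (A (x) 1_K) P + a_00 Q], where [P] is the block diagonal projection
    with blocks [P_j] and [Q = 1 - P]. The space on which it is represented is
    the direct sum of [n.+1] copies of the [K]-dimensional space. *)
Section Maps.
Variables (n K : nat) (f : 'I_n.+1 -> 'cV[C]_K).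
Hypothesis hf : forall j, unit_or_zero (f j).
Hypothesis f0 : f ord0 = 0.
Local Notation N := (\sum_(j < n.+1) K)%N.
Local Notation e j := (delta_mx j 0 : 'cV[C]_n.+1).

(** The Kraus operators of [A |-> P (A (x) 1_K) P]: the restriction to the
    [t]-th coordinate of each block, after [P]. *)
Definition Tmx (t : 'I_K) : 'M[C]_(n.+1, N) :=
  \mxrow_(j < n.+1) (e j *m row t (perp (f j))).

(** The row [f_p^*] placed in the [p]-th block. *)
Definition rmx (p : 'I_n.+1) : 'M[C]_(1, N) :=
  \mxrow_(j < n.+1) (if j == p then (f p)^t* else 0).

(** The Kraus operators of [A |-> a_00 Q], which makes the map unital. *)
Definition Smx (p : 'I_n.+1) : 'M[C]_(n.+1, N) := e ord0 *m rmx p.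

(** The defect in [T_s T_t^* = delta_st]. *)
Definition Emx (s t : 'I_K) : 'M[C]_n.+1 :=
  diag_mx (\row_j (f j s 0 * (f j t 0)^*)).

(** The projection onto the span of the [e_j] with [f_j = 0]. *)
Definition Gmx : 'M[C]_n.+1 :=
  diag_mx (\row_j (1 - \sum_t f j t 0 * (f j t 0)^*)).

(** All the Kraus operators. *)
Definition Vmx (x : 'I_K + 'I_n.+1) : 'M[C]_(n.+1, N) :=
  match x with inl t => Tmx t | inr p => Smx p end.

Lemma ctr_mxrow m (B : 'I_n.+1 -> 'M[C]_(m, K)) :
  (\mxrow_(j < n.+1) B j)^t* = \mxcol_(j < n.+1) (B j)^t*.
Proof. by rewrite tr_mxrow; apply/matrixP => i j; rewrite !mxE. Qed.

Lemma e_dot i j : (e i)^t* *m e j = (i == j)%:R%:M.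
Proof.
rewrite ctr_delta; apply/matrixP => a b; rewrite !ord1.
case: eqP => [->|/eqP ij]; first by rewrite mul_delta_mx !mxE.
by rewrite mul_delta_mx_0// !mxE.
Qed.

Lemma kraus_resolution :
  \sum_t (Tmx t)^t* *m Tmx t + \sum_p (Smx p)^t* *m Smx p = 1%:M.
Proof.
transitivity (ampl n.+1 (1%:M : 'M[C]_K)); last exact: ampl1.
have Tg t : (Tmx t)^t* *m Tmx t = \mxblock_(j < n.+1, l < n.+1)
    ((j == l)%:R *: ((row t (perp (f j)))^t* *m row t (perp (f l)))).
  rewrite /Tmx ctr_mxrow mul_mxcol_mxrow; apply: eq_mxblock => j l.
  by rewrite ctrM mulmxA -(mulmxA _ _ (e _)) e_dot mul_mx_scalar -scalemxAl.
have Sg p : (Smx p)^t* *m Smx p = \mxblock_(j < n.+1, l < n.+1)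
    ((if j == p then (f p)^t* else 0)^t* *m (if l == p then (f p)^t* else 0)).
  rewrite /Smx ctrM mulmxA -(mulmxA _ _ (e _)) e_dot eqxx mulmx1.
  by rewrite ctr_mxrow mul_mxcol_mxrow.
rewrite (eq_bigr _ (fun t _ => Tg t)) (eq_bigr _ (fun p _ => Sg p)).
rewrite -!mxblock_sum -mxblockD /ampl; apply: eq_mxblock => j l.
rewrite -scaler_sumr sum_row_gram.
have -> : \sum_p (if j == p then (f p)^t* else 0)^t* *m
    (if l == p then (f p)^t* else 0) =
    if j == l then f j *m (f j)^t* else 0.
  rewrite (bigD1 j)//= eqxx big1 ?addr0 => [|p /negPf jp].
    rewrite ctrK eq_sym; case: eqP => // _; exact: mulmx0.
  by rewrite eq_sym jp ctr0 mul0mx.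
case: eqP => [->|_]; last by rewrite scale0r addr0.
by rewrite scale1r perp_gram.
Qed.

Lemma Smx_Tmx t p : Smx p *m (Tmx t)^t* = 0.
Proof.
rewrite /Smx /Tmx ctr_mxrow -mulmxA mul_mxrow_mxcol big1 ?mulmx0// => j _.
case: eqP => [->|_]; last exact: mul0mx.
rewrite ctrM mulmxA -ctrM -row_mul perp_mul//.
by rewrite row0 ctr0 mul0mx.
Qed.

Lemma Tmx_Tmx s t :
  Tmx s *m (Tmx t)^t* = (if s == t then 1%:M else 0) - Emx s t.
Proof.
rewrite /Tmx ctr_mxrow mul_mxrow_mxcol.
transitivity (\sum_j perp (f j) s t *: (delta_mx j j : 'M[C]_n.+1)).
  apply: eq_bigr => j _; rewrite ctrM mulmxA -(mulmxA (e j)).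
  have -> : row s (perp (f j)) *m (row t (perp (f j)))^t* = (perp (f j) s t)%:M.
    apply/matrixP => a b; rewrite !ord1 [RHS]mxE eqxx mulr1n.
    rewrite -[in RHS](perp_idem (hf j)) -[in X in _ = (_ *m X) _ _]perp_ctr.
    by rewrite !mxE; apply: eq_bigr => i _; rewrite !mxE.
  by rewrite mul_mx_scalar -scalemxAl ctr_delta mul_delta_mx.
apply/matrixP => a b; rewrite summxE (bigD1 a)//= big1 ?addr0; last first.
  by move=> j /negPf ja; rewrite !mxE [a == j]eq_sym ja mulr0.
rewrite !mxE eqxx big_ord1 !mxE.
have [->|ab] := eqVneq a b; have [st|st] := eqVneq s t.
- by rewrite mxE eqxx mulr1.
- by rewrite mxE mulr1.
- by rewrite mxE (negPf ab) mulr0 subr0.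
- by rewrite mxE mulr0 subr0.
Qed.

Lemma sum_norm_f j : let c := \sum_t f j t 0 * (f j t 0)^* in c = 0 \/ c = 1.
Proof.
case: (hf j) => h /=; [left|right].
  by rewrite h big1// => t _; rewrite mxE mul0r.
have /matrixP/(_ 0 0) := h; rewrite !mxE eqxx => h1.
rewrite -[RHS]h1.
by apply: eq_bigr => t _; rewrite !mxE mulrC.
Qed.

Lemma diag_gram (a b : 'I_n.+1 -> C) :
  (diag_mx (\row_j a j))^t* *m diag_mx (\row_j b j) =
  diag_mx (\row_j ((a j)^* * b j)).
Proof.
rewrite tr_diag_mx map_diag_mx mulmx_diag; congr diag_mx.
by apply/rowP => j; rewrite !mxE.
Qed.

Lemma sum_Emx_sqr :
  \sum_t \sum_s (Emx s t)^t* *m Emx s t + Gmx^t* *m Gmx = 1%:M.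
Proof.
under eq_bigr do under eq_bigr do rewrite diag_gram.
rewrite diag_gram.
under eq_bigr do rewrite -raddf_sum.
rewrite -raddf_sum -raddfD -[1%:M]diag_const_mx; congr diag_mx.
apply/rowP => j; rewrite !mxE summxE.
under eq_bigr do (rewrite summxE; under eq_bigr do rewrite mxE).
set c := \sum_t f j t 0 * (f j t 0)^*.
have -> : \sum_t \sum_s (f j s 0 * (f j t 0)^*)^* * (f j s 0 * (f j t 0)^*)
   = c * c.
  rewrite [in RHS]/c mulr_sumr; apply: eq_bigr => t _.
  rewrite mulr_suml; apply: eq_bigr => s _.
  by rewrite rmorphM /= conjCK; ring.
by case: (sum_norm_f j); rewrite -/c => ->;
  rewrite ?subr0 ?subrr ?rmorph1 ?mulr0 ?mulr1 ?addr0 ?add0r.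
Qed.

Lemma sum_Emx_diag : \sum_t Emx t t + Gmx^t* *m Gmx = 1%:M.
Proof.
rewrite diag_gram -raddf_sum -raddfD -[1%:M]diag_const_mx; congr diag_mx.
apply/rowP => j; rewrite !mxE summxE.
under eq_bigr do rewrite mxE.
set c := \sum_t f j t 0 * (f j t 0)^*.
by case: (sum_norm_f j); rewrite -/c => ->;
  rewrite ?subr0 ?subrr ?rmorph1 ?mulr0 ?mulr1 ?addr0 ?add0r.
Qed.

Lemma kraus_unital : kraus Vmx 1%:M = 1%:M.
Proof.
rewrite -kraus_resolution /kraus big_sumType /=.
by congr (_ + _); apply: eq_bigr => i _; rewrite mulmx1.
Qed.

(** Since [f_0 = 0], the projection [P_0] is the identity, so that [e_i0] acts
    as [P_i] from the block 0 to the block [i]; the scalar [a_00] vanishes. *)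
Lemma kraus_column (w : 'cV[C]_N) (i : 'I_n.+1) : i != ord0 ->
  sqn (kraus Vmx (delta_mx i ord0) *m w) = sqn (perp (f i) *m submxcol w ord0).
Proof.
move=> i0; have dE : delta_mx i ord0 = e i *m (e ord0)^t* :> 'M[C]_n.+1.
  by rewrite ctr_delta mul_delta_mx.
rewrite (krausD (T := Tmx) (S := Smx))// mulmxDl.
have -> : kraus Smx (delta_mx i ord0) = 0.
  rewrite /kraus [LHS]big1// => p _; rewrite /Smx ctrM dE.
  by rewrite !mulmxA -(mulmxA _ _ (e i)) e_dot eq_sym (negPf i0) mul_mx_scalar
    scale0r !mul0mx.
rewrite mul0mx addr0.
have Tw t : (e ord0)^t* *m (Tmx t *m w) = row t (submxcol w ord0).
  rewrite -[w in LHS]submxcolK mul_mxrow_mxcol mulmx_sumr (bigD1 ord0)//=.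
  rewrite [X in _ + X]big1 ?addr0 => [|j /negPf j0]; last first.
    by rewrite !mulmxA e_dot eq_sym j0 mul_scalar_mx scale0r !mul0mx.
  rewrite !mulmxA e_dot eqxx mul1mx f0 /perp mul0mx subr0.
  by rewrite row1 -rowE.
have Te t : (Tmx t)^t* *m e i =
    \mxcol_(j < n.+1) (if j == i then (row t (perp (f i)))^t* else 0).
  rewrite /Tmx ctr_mxrow mxcol_mul; apply: eq_mxcol => j.
  rewrite ctrM -mulmxA e_dot; case: eqP => [->|_]; first exact: mulmx1.
  by rewrite mul_mx_scalar scale0r.
have -> : kraus Tmx (delta_mx i ord0) *m w =
  \mxcol_(j < n.+1) (if j == i then perp (f i) *m submxcol w ord0 else 0).
  rewrite /kraus mulmx_suml.
  transitivity (\sum_t (\mxcol_(j < n.+1)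
    (if j == i then (row t (perp (f i)))^t* *m row t (submxcol w ord0)
     else 0))).
    apply: eq_bigr => t _.
    rewrite dE -!mulmxA Tw mulmxA Te mxcol_mul; apply: eq_mxcol => j.
    by case: eqP => // _; rewrite mul0mx.
  rewrite -mxcol_sum; apply: eq_mxcol => j.
  case: eqP => [_|_]; last by rewrite big1.
  by rewrite sum_row_gram perp_ctr.
rewrite sqn_mxcol (bigD1 i)//= eqxx big1 ?addr0// => j /negPf->; exact: sqn0.
Qed.

End Maps.
End Construction.

(** * A finite net of lines *)

Section Net.
Context {R : realType}.
Local Notation C := R[i].

Lemma grid1 (M : nat) (x : R) : (0 < M)%N -> -1 <= x <= 1 ->
  exists a : 'I_(2 * M).+1, (x - (a%:R / M%:R - 1)) ^+ 2 <= (M%:R ^- 2).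
Proof.
move=> M0 /andP[x1 x2]; have m0 : 0 < M%:R :> R by rewrite ltr0n.
pose y := (x + 1) * M%:R.
have y0 : 0 <= y by rewrite mulr_ge0// -lerBlDr sub0r.
have /andP[ay ya] := truncn_itv y0.
have aM : (Num.truncn y < (2 * M).+1)%N.
  rewrite ltnS -(ler_nat R); apply: le_trans ay _.
  by rewrite natrM ler_wpM2r// ?ler0n//; lra.
exists (Ordinal aM) => /=.
move: ay ya; set a := Num.truncn y; rewrite -natr1; move: (a%:R : R) => b ay ya.
have -> : x - (b / M%:R - 1) = (y - b) / M%:R.
  by rewrite /y; field; rewrite gt_eqF.
rewrite exprMn exprVn ler_piMl ?invr_ge0 ?exprn_ge0//.
by rewrite expr_le1//; lra.
Qed.

Lemma sqr_normc (z : C) :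
  Normc.normc z ^+ 2 = complex.Re z ^+ 2 + complex.Im z ^+ 2.
Proof. by case: z => x y /=; rewrite sqr_sqrtr// addr_ge0 ?sqr_ge0. Qed.

Lemma finite_net (K : nat) : exists (G : finType) (u : G -> 'cV[C]_K),
  forall w, sqn w <= 1 -> exists g, sqn (w - u g) <= 64^-1.
Proof.
have [->|K0] := posnP K.
  exists unit, (fun=> 0) => w _; exists tt.
  by rewrite /sqn big_ord0 invr_ge0.
(* the squared error is at most K * 2 / M^2 = 1 / (8192 K) *)
pose M := (128 * K)%N; have M0 : (0 < M)%N by rewrite muln_gt0.
pose c (a : 'I_(2 * M).+1) : R := a%:R / M%:R - 1.
exists {ffun 'I_K -> 'I_(2 * M).+1 * 'I_(2 * M).+1},
  (fun g : {ffun _} => \col_(t < K) Complex (c (g t).1) (c (g t).2)) => w w1.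
have w1' t : Normc.normc (w t 0) ^+ 2 <= 1.
  apply: le_trans w1; rewrite /sqn (bigD1 t)//= lerDl.
  by apply: sumr_ge0 => i _; exact: sqr_ge0.
have sq1 (x y : R) : x ^+ 2 + y ^+ 2 <= 1 -> -1 <= x <= 1.
  move=> h; rewrite -ler_norml -(@ler_pXn2r _ 2) ?nnegrE//.
  by rewrite real_normK ?num_real// expr1n; have := sqr_ge0 y; lra.
have ex t : exists p : 'I_(2 * M).+1 * 'I_(2 * M).+1,
    (complex.Re (w t 0) - c p.1) ^+ 2 + (complex.Im (w t 0) - c p.2) ^+ 2
    <= 2 * M%:R ^- 2.
  have := w1' t; rewrite sqr_normc => h.
  have [a ha] := grid1 M0 (sq1 _ _ h).
  rewrite addrC in h; have [b hb] := grid1 M0 (sq1 _ _ h).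
  by exists (a, b); rewrite mulr_natl mulr2n lerD.
have [g hg] := choice ex; exists (finfun g).
apply: (@le_trans _ _ (\sum_(t < K) 2 * M%:R ^- 2)).
  apply: ler_sum => t _; rewrite sqr_normc !mxE ffunE; apply: le_trans (hg t).
  by case: (w t 0).
rewrite sumr_const card_ord -[leLHS]mulr_natl /M natrM.
have k1 : 1 <= K%:R :> R by rewrite ler1n.
move: (K%:R : R) k1 => k k1.
have -> : k * (2 * (128%:R * k) ^- 2) = 8192^-1 / k.
  by field; rewrite gt_eqF ?(lt_le_trans ltr01).
rewrite ler_pdivrMr ?(lt_le_trans ltr01)//; lra.
Qed.

(** The index 0 is reserved for the zero vector; the other vectors are the
    normalized points of a net of the unit ball. A point 0 of the net stays 0,
    by the convention on the inverse of 0. *)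
Lemma projective_net (K : nat) : exists (n : nat) (f : 'I_n.+1 -> 'cV[C]_K),
  [/\ f ord0 = 0, forall j, unit_or_zero (f j) &
      forall w, sqn w <= 1 ->
        exists2 i, i != ord0 & sqn (perp (f i) *m w) <= 64^-1].
Proof.
have [G [u hu]] := finite_net K.
pose h (v : 'cV[C]_K) := ((l2norm v)^-1)%:C%C *: v.
exists #|G|,
  (fun j => if unlift ord0 j is Some i then h (u (enum_val i)) else 0).
have hh v : unit_or_zero (h v).
  have [->|v0] := eqVneq v 0; first by left; rewrite /h scaler0.
  right; apply/matrixP => a b; rewrite !ord1 sqn_dot sqnZ /=.
  rewrite expr0n addr0 sqr_sqrtr ?sqr_ge0// exprVn l2norm_sqr mulVf ?sqn_eq0//.
  by rewrite !mxE eqxx.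
split; first by rewrite unlift_none.
  by move=> j; case: unlift => [i|]; [exact: hh|left].
move=> w /hu[g wg]; exists (lift ord0 (enum_rank g)).
  by rewrite eq_sym neq_lift.
rewrite liftK enum_rankK; set v := u g in wg *.
apply: le_trans wg.
suff [c vE] : exists c, v = c *: h v by rewrite [in leRHS]vE; exact: sqn_perp.
exists (l2norm v)%:C%C; rewrite /h scalerA -rmorphM /=.
have [->|v0] := eqVneq v 0; first by rewrite scaler0.
rewrite mulfV ?scale1r// l2norm_sqn gt_eqF// sqrtr_gt0 lt_def sqn_ge0.
by rewrite sqn_eq0 v0.
Qed.

End Net.

(** * Distance to the complete order embeddings *)

Theorem corollary2p17 (R : realType) (eps : R) (heps : 0 < eps) :
  exists (n N : nat) (phi : {linear 'M[R[i]]_n -> 'M[R[i]]_N}),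
    [/\ (0 < n)%N, (0 < N)%N &
      [/\ injective phi,
          phi 1%:M = 1%:M,
          completely_positive phi,
          (cbnorm_inv phi <= (1 + eps)%:E)%E &
          forall psi : {linear 'M[R[i]]_n -> 'M[R[i]]_N},
            complete_order_embedding psi ->
            ((3 / 4)%:E <= opnorm (fun A => phi A - psi A)%R)%E]].
Proof.
pose K := (Num.truncn ((1 + eps) * (2 + eps^-1) / eps)).+1.
have hK : (1 + eps) * (2 + eps^-1) <= eps * K%:R.
  by rewrite [leRHS]mulrC -ler_pdivrMr// ltW// truncnS_gt.
have [n [f [f0 hf net]]] := projective_net (R := R) K.
exists n.+1, (\sum_(j < n.+1) K)%N, (kraus (Vmx f)).
have VT t : Vmx f (inl t) = Tmx f t by [].
have VS p : Vmx f (inr p) = Smx f p by [].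
have hI : (1 + eps) * (2 + eps^-1) <= eps * #|'I_K|%:R by rewrite card_ord.
split; [by []|by rewrite sum_nat_const card_ord muln_gt0|split].
- exact: (kraus_inj (kraus_resolution hf) (Smx_Tmx hf) (Tmx_Tmx hf)
    (sum_Emx_sqr hf) (sum_Emx_diag hf) heps hI VT VS).
- exact: kraus_unital.
- exact: kraus_cp.
- exact: (kraus_cbnorm_inv (kraus_resolution hf) (Smx_Tmx hf) (Tmx_Tmx hf)
    (sum_Emx_sqr hf) (sum_Emx_diag hf) heps hI VT VS).
move=> psi [_ ci].
have [w w1 hw] : exists2 w, sqn w <= 1 &
    forall i, 1 - 10^-1 <= sqn (psi (delta_mx i ord0) *m w).
  by apply: ci_column => //; lra.
(* the block 0 of w is close to the line of f_i *)
have [|i i0 hi] := net (submxcol w ord0).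
  apply: le_trans w1; rewrite sqn_submxcol (bigD1 ord0)//= lerDl.
  by apply: sumr_ge0 => i _; exact: sqn_ge0.
apply: (opnorm_ge (mxopnorm_delta i ord0)).
set D := _ - _.
have h2 := mxopnormP D w.
have psiE : psi (delta_mx i ord0) *m w =
    - (D *m w) + kraus (Vmx f) (delta_mx i ord0) *m w.
  by rewrite -mulNmx -mulmxDl /D opprB subrK.
(* 9/10 <= 3/2 * |D w|^2 + 3 * 1/64 yields |D w|^2 >= 9/16 *)
have half0 : 0 < 1 / 2 :> R by lra.
have := sqnD_le (- (D *m w)) (kraus (Vmx f) (delta_mx i ord0) *m w) half0.
rewrite -psiE sqnN kraus_column// => h3.
have {}hw := hw i.
rewrite -(@ler_pXn2r _ 2) ?nnegrE ?mxopnorm_ge0//.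
have : sqn (D *m w) <= mxopnorm D ^+ 2.
  by apply: le_trans h2 _; rewrite ler_piMr ?sqr_ge0.
move: h3 hw hi; rewrite invf_div; lra.
Qed.
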